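(* Let $T$ be a tree, $\mu:T\to\mathbb{R}$ a positive function, and $L_\mu^\infty(T)$ the associated weighted Banach space. Then the differentiation operator $D$ is bounded on $L_\mu^\infty(T)$ if and only if \[\sup_{v\in T^*}\frac{\mu(v)}{\mu(b(v))}<\infty.\] Moreover, in that case, \[\|D\|=1+\sup_{v\in T^*}\frac{\mu(v)}{\mu(b(v))}.\]
   Context: A tree $T$ is a locally finite, connected, simply-connected graph, identified with its set of vertices. A vertex is terminal if it has a unique neighbor; all trees are assumed to be without terminal vertices (hence infinite) and rooted at a vertex $o$; $T^*=T\setminus\{o\}$. For $v\neq o$, $v^-$ denotes the unique neighbor of $v$ lying on the path from $o$ to $v$ (the parent of $v$). The backward shift map $b:T\to T$ is $b(v)=v^-$ for $v\neq o$ and $b(o)=o$. The derivative of $f:T\to\mathbb{C}$ is $f'(v)=f(v)-f(b(v))$ for all $v\in T$ (so $f'(o)=0$); the differentiation operator is $Df=f'$. For a positive function (weight) $\mu:T\to\mathbb{R}$, the weighted Banach space $L_\mu^\infty(T)$ is the set of all $f:T\to\mathbb{C}$ with $\sup_{v\in T}\mu(v)|f(v)|<\infty$; it is a Banach space under $\|f\|_\mu=\sup_{v\in T}\mu(v)|f(v)|$. $D$ is bounded on $L_\mu^\infty(T)$ if it is a bounded linear operator from $L_\mu^\infty(T)$ to itself; $\|D\|$ is its operator norm. *)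

(* Defs.v *)
From HB Require Import structures.
From mathcomp Require Import all_boot all_order all_algebra.
From mathcomp Require Import all_classical all_reals all_analysis.
From mathcomp.real_closed Require Import complex.

Set Implicit Arguments.
Unset Strict Implicit.
Unset Printing Implicit Defensive.
Import Order.TTheory GRing.Theory Num.Theory.
Import ComplexField.Normc.

Local Open Scope classical_set_scope.
Local Open Scope ring_scope.

(* A graph is given by its adjacency relation on the set [T] of vertices. *)
Section Tree.
Context {T : choiceType}.
Implicit Types (adj : rel T) (o u v w : T).

Definition locally_finite adj := forall v, finite_set [set w | adj v w].

Definition connected_graph adj :=
  forall u v, exists2 p, path adj u p & last u p = v.

(* No cycles: [ucycle adj c] holds for the two-element sequence formed by the
   endpoints of an edge, so a cycle of the graph is a [ucycle] of size > 2. *)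
Definition simply_connected adj :=
  forall c, ucycle adj c -> (size c <= 2)%N.

Definition is_tree adj :=
  [/\ symmetric adj, irreflexive adj, locally_finite adj,
      connected_graph adj & simply_connected adj].

Definition terminal adj v := exists! w, adj v w.

Definition on_path_to adj o v w :=
  exists p, [/\ path adj o p, uniq (o :: p), last o p = v & w \in o :: p].

Definition is_parent adj o v w := adj v w /\ on_path_to adj o v w.

(* The default value of [xget] is never used: see [is_parent_unique]. *)
Definition bshift adj o v : T :=
  if v == o then o else xget o [set w | is_parent adj o v w].

Lemma is_parent_unique adj o v :
  is_tree adj -> v != o -> exists! w, is_parent adj o v w.
Proof.
move=> [adjC adjI _ conn acyc] vo.
have [p0 p0P lp0] := conn o v.
have [p [pP pu lp]] : exists p, [/\ path adj o p, uniq (o :: p) & last o p = v].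
  by case/shortenP: p0P lp0 => p pP pu _ lp; exists p.
have before w q : path adj o q -> uniq (o :: q) -> last o q = v ->
    w \in o :: q -> w != v ->
    exists q', [/\ path adj o q', last o q' = w & v \notin o :: q'].
  move=> + + + wq; case/splitPl: wq => q1 q2 lq1.
  rewrite cat_path last_cat -cat_cons cat_uniq.
  move=> /andP[q1P _] /and3P[_ q12 _] lq2 wv; exists q1; split=> //.
  apply: contra q12 => vq1; apply/hasP; exists v => //.
  case: q2 lq2 => [|x q2] /= lq2; last by rewrite -lq2 mem_last.
  by rewrite -lq1 lq2 eqxx in wv.
case: (lastP p) pP pu lp => [_ _ /= ov|q x]; first by rewrite ov eqxx in vo.
move=> pP pu; rewrite last_rcons => xv; subst x.
exists (last o q); split.
  split; first by move: pP; rewrite rcons_path adjC => /andP[].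
  exists (rcons q v); split; rewrite ?last_rcons//.
  by rewrite -rcons_cons mem_rcons inE mem_last orbT.
move=> w2 [aw2 [p2 [p2P p2u lp2 w2p2]]].
set w1 := last o q.
have aw1 : adj v w1 by move: pP; rewrite rcons_path adjC => /andP[].
have w2v : w2 != v by apply: contraTneq aw2 => ->; rewrite adjI.
have [q2 [q2P lq2 vq2]] := before _ _ p2P p2u lp2 w2p2 w2v.
have qP : path adj o q by move: pP; rewrite rcons_path => /andP[].
have vq : v \notin o :: q.
  by move: pu; rewrite -rcons_cons rcons_uniq => /andP[].
pose r := rev (belast o q) ++ q2.
have lbr : last w1 (rev (belast o q)) = o.
  rewrite /w1; case: (q) => [//|y s].
  by rewrite [belast _ _]/= rev_cons last_rcons.
have rP : path adj w1 r.
  rewrite cat_path lbr q2P andbT rev_path.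
  by under eq_path do rewrite adjC.
have lr : last w1 r = w2 by rewrite last_cat lbr.
have vr : v \notin w1 :: r.
  rewrite inE mem_cat mem_rev negb_or negb_or; apply/and3P; split.
  - by apply: contraNneq vq => ->; rewrite mem_last.
  - by apply: contra vq => /mem_belast.
  - by move: vq2; rewrite inE negb_or => /andP[].
case/shortenP: rP lr => r' r'P r'u sub lr'.
have vr' : v \notin w1 :: r'.
  by apply: contra vr; rewrite !inE => /orP[->//|/sub ->]; rewrite orbT.
case: r' r'P r'u lr' vr' {sub} => [//|y s] r'P r'u lr' vr'.
have cyc : ucycle adj [:: v, w1, y & s].
  apply/andP; split; last by rewrite cons_uniq vr'.
  rewrite /cycle -[rcons _ _]/(w1 :: rcons (y :: s) v).
  rewrite -[path _ _ _]/(adj v w1 && path adj w1 (rcons (y :: s) v)).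
  by rewrite aw1 rcons_path r'P lr' adjC aw2.
by have := acyc _ cyc.
Qed.

End Tree.

Section Operators.
Context {R : realType} {T : choiceType}.
Implicit Types (adj : rel T) (o : T) (mu : T -> R) (f g : T -> R[i]).

Definition diff_op adj o f : T -> R[i] := fun v => f v - f (bshift adj o v).

(* [normc] is the modulus, as an element of [R] rather than of [R[i]]. *)
Definition wnorm mu f : \bar R :=
  ereal_sup [set (mu v * normc (f v))%:E | v in [set: T]].

Definition Linfty mu : set (T -> R[i]) := [set f | (wnorm mu f < +oo)%E].

Definition bounded_operator mu (A : (T -> R[i]) -> (T -> R[i])) : Prop :=
  [/\ forall f, Linfty mu f -> Linfty mu (A f),
      forall (a : R[i]) f g, Linfty mu f -> Linfty mu g ->
        A (fun v => a * f v + g v) = (fun v => a * A f v + A g v)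
    & exists M : R, forall f, Linfty mu f ->
        (wnorm mu (A f) <= M%:E * wnorm mu f)%E].

Definition opnorm mu (A : (T -> R[i]) -> (T -> R[i])) : \bar R :=
  ereal_sup [set wnorm mu (A f) | f in
    [set f | Linfty mu f /\ (wnorm mu f <= 1)%E]].

End Operators.

(* Main.v *)
Require Import Defs.
From mathcomp Require Import all_boot all_order all_algebra.
From mathcomp Require Import all_classical all_reals all_analysis.
From mathcomp.real_closed Require Import complex.

Import Order.TTheory GRing.Theory Num.Theory.
Local Open Scope classical_set_scope.
Local Open Scope ring_scope.

(** Write [b] for the backward shift and [S] for the supremum of the ratios
    [mu v / mu (b v)] over [v != o].

    The upper bound on the norm is the triangle inequality:
    [mu v |f v - f (b v)| <= mu v |f v| + (mu v / mu (b v)) mu (b v) |f (b v)|],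
    hence [||D f|| <= (1 + S) ||f||] ([wnorm_diff_op_le]); at the root [D f]
    vanishes.

    The lower bound comes from one test function for each [v != o].  The two
    terms of [f v - f (b v)] add up when [f v] and [f (b v)] have opposite
    signs, so [f] is [1 / mu v] at [v], [- 1 / mu (b v)] at [b v] and zero
    elsewhere.  As a vertex differs from its parent, [f] is well defined and
    has norm at most 1, while [mu v |D f v| = 1 + mu v / mu (b v)]
    ([wnorm_edge_fun_le1], [le_wnorm_diff_edge_fun]).  Any bound for [D] on the
    unit ball is thus at least [1 + mu v / mu (b v)] for every [v != o], which
    yields both the finiteness of [S] and [1 + S <= ||D||]. *)

Import ComplexField.Normc.

Lemma normc_real (R : rcfType) (x : R) : normc (x%:C)%C = `|x|.
Proof. by rewrite /normc /= expr0n /= addr0 sqrtr_sqr. Qed.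

Lemma normc_ge0 (R : rcfType) (z : R[i]) : 0 <= normc z.
Proof. by case: z => x y; exact: sqrtr_ge0. Qed.

Section WeightedNorm.
Context {R : realType} {T : choiceType} (mu : T -> R).
Implicit Types (f : T -> R[i]) (c : R).

Lemma wnorm_leP f c :
  (wnorm mu f <= c%:E)%E <-> forall v, mu v * normc (f v) <= c.
Proof.
split=> [fc v|fc].
  by rewrite -lee_fin; apply: le_trans fc; apply: ereal_sup_ubound; exists v.
by apply: ge_ereal_sup => _ [v _ <-]; rewrite lee_fin.
Qed.

Lemma le_wnorm f v : ((mu v * normc (f v))%:E <= wnorm mu f)%E.
Proof. by apply: ereal_sup_ubound; exists v. Qed.

Hypothesis mu_ge0 : forall v, 0 <= mu v.

(** A point of [T] is required: over an empty [T] every norm is [-oo]. *)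
Lemma wnorm_ge0 f (v : T) : (0 <= wnorm mu f)%E.
Proof.
by apply: le_trans (le_wnorm f v); rewrite lee_fin mulr_ge0 ?mu_ge0 ?normc_ge0.
Qed.

Lemma Linfty_wnormE f (v : T) :
  Linfty mu f -> exists2 c, 0 <= c & wnorm mu f = c%:E.
Proof.
rewrite /Linfty /= => ff; exists (fine (wnorm mu f)).
  exact/fine_ge0/(wnorm_ge0 f v).
by rewrite fineK// ge0_fin_numE// (wnorm_ge0 f v).
Qed.

End WeightedNorm.

Lemma bshift_root (T : choiceType) (adj : rel T) (o : T) : bshift adj o o = o.
Proof. by rewrite /bshift eqxx. Qed.

(** The parent is a neighbor, and a tree has no loops. *)
Lemma bshift_neq (T : choiceType) (adj : rel T) (o v : T) :
  is_tree adj -> v != o -> bshift adj o v != v.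
Proof.
move=> tree_adj vo; rewrite /bshift (negbTE vo).
have [w [parent_w _]] := is_parent_unique tree_adj vo.
have [adj_vb _] := @xgetPex _ o _ (ex_intro (is_parent adj o v) w parent_w).
have [_ adj_irr _ _ _] := tree_adj.
by apply: contraTneq adj_vb => ->; rewrite adj_irr.
Qed.

Section Differentiation.
Context {R : realType} {T : choiceType} (adj : rel T) (o : T) (mu : T -> R).
Hypothesis mu_pos : forall v, 0 < mu v.
Local Notation b := (bshift adj o).
Local Notation D := (@diff_op R T adj o).

Let mu_ge0 v : 0 <= mu v. Proof. exact/ltW. Qed.

Lemma diff_op_linear (a : R[i]) (f g : T -> R[i]) :
  D (fun v => a * f v + g v) = (fun v => a * D f v + D g v).
Proof. by apply/funext => v; rewrite /diff_op mulrBr opprD addrACA. Qed.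

(** The weight at [v] acts on [f (b v)], which is controlled only by the weight
    at [b v]: the ratio of the two weights is the price of the shift. *)
Lemma wnorm_diff_op_le (s c : R) (f : T -> R[i]) :
  0 <= s -> 0 <= c -> (forall v, v != o -> mu v / mu (b v) <= s) ->
  (wnorm mu f <= c%:E)%E -> (wnorm mu (D f) <= ((1 + s) * c)%:E)%E.
Proof.
move=> s0 c0 ratio_s /wnorm_leP fc; apply/wnorm_leP => v.
have [->|vo] := eqVneq v o.
  rewrite /diff_op bshift_root subrr -[X in normc X]/(0%:C)%C.
  by rewrite normc_real normr0 mulr0 mulr_ge0 ?addr_ge0.
have tri : normc (D f v) <= normc (f v) + normc (f (b v)).
  by rewrite /diff_op (le_trans (le_normcD _ _))// normcN.
apply: le_trans (ler_wpM2l (mu_ge0 v) tri) _.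
rewrite mulrDr mulrDl mul1r lerD ?fc//.
rewrite -[mu v](divfK (lt0r_neq0 (mu_pos (b v)))) -[_ / _ * _ * _]mulrA.
apply: ler_pM; [exact: divr_ge0 | | exact: ratio_s | exact: fc].
by rewrite mulr_ge0 ?normc_ge0.
Qed.

(** On this function the two terms of [D] at [v] reinforce each other, each
    being as large as the unit ball allows. *)
Definition edge_fun (v : T) : T -> R[i] := fun w =>
  ((if w == v then (mu v)^-1
    else if w == b v then - (mu (b v))^-1 else 0)%:C)%C.

Lemma wnorm_edge_fun_le1 v : (wnorm mu (edge_fun v) <= 1)%E.
Proof.
apply/wnorm_leP => w; rewrite /edge_fun normc_real.
have [->|_] := eqVneq w v.
  by rewrite ger0_norm ?invr_ge0// divff// lt0r_neq0.
have [->|_] := eqVneq w (b v); last by rewrite normr0 mulr0.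
by rewrite normrN ger0_norm ?invr_ge0// divff// lt0r_neq0.
Qed.

Lemma Linfty_edge_fun v : Linfty mu (edge_fun v).
Proof. exact: le_lt_trans (wnorm_edge_fun_le1 v) (ltry 1). Qed.

Lemma le_wnorm_diff_edge_fun v : b v != v ->
  ((1 + mu v / mu (b v))%:E <= wnorm mu (D (edge_fun v)))%E.
Proof.
move=> bv; apply: le_trans (le_wnorm mu _ v).
rewrite /diff_op /edge_fun eqxx (negbTE bv) eqxx -rmorphB normc_real opprK.
rewrite lee_fin ger0_norm ?addr_ge0 ?invr_ge0//.
by rewrite mulrDr divff// lt0r_neq0.
Qed.

End Differentiation.

Theorem theorem4p2 (R : realType) (T : choiceType) (adj : rel T) (o : T)
    (mu : T -> R)
    (tree_adj : is_tree adj)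
    (no_terminal : forall v : T, ~ terminal adj v)
    (infinite_T : infinite_set [set: T])
    (mu_pos : forall v : T, 0 < mu v) :
  (bounded_operator mu (diff_op adj o) <->
     (ereal_sup [set (mu v / mu (bshift adj o v))%:E | v in [set v | v != o]]
        < +oo)%E) /\
  (bounded_operator mu (diff_op adj o) ->
     opnorm mu (diff_op adj o) =
     (1 + ereal_sup
        [set (mu v / mu (bshift adj o v))%:E | v in [set v | v != o]])%E).
Proof.
set b := bshift adj o; set D := diff_op adj o.
set S := ereal_sup _.
have mu_ge0 v : 0 <= mu v by exact/ltW.
have ratio_le_S v : v != o -> ((mu v / mu (b v))%:E <= S)%E.
  by move=> vo; apply: ereal_sup_ubound; exists v.
have [v0 v0o] : exists v, v != o.
  have [v [_ /= /eqP vo]] := infinite_setN0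
    (infinite_setD infinite_T (finite_set1 o)).
  by exists v.
have S_ge0 : (0 <= S)%E.
  by apply: le_trans (ratio_le_S _ v0o); rewrite lee_fin divr_ge0.
have S_finite : (S < +oo)%E -> exists2 s, 0 <= s & S = s%:E.
  move=> Sfin; exists (fine S); first exact: fine_ge0.
  by rewrite fineK// ge0_fin_numE.
have D_le s f c : S = s%:E -> 0 <= s -> 0 <= c -> (wnorm mu f <= c%:E)%E ->
    (wnorm mu (D f) <= ((1 + s) * c)%:E)%E.
  move=> Ss s0 c0; apply: wnorm_diff_op_le => // v vo.
  by rewrite -lee_fin -Ss; exact: ratio_le_S.
have S_le (M : R) : (forall v, v != o ->
      (wnorm mu (D (edge_fun adj o mu v)) <= M%:E)%E) -> (S <= (M - 1)%:E)%E.
  move=> DM; apply: ge_ereal_sup => _ [v vo <-].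
  rewrite lee_fin lerBrDl -lee_fin; apply: le_trans (DM v vo).
  exact/le_wnorm_diff_edge_fun/bshift_neq.
have S_bounded : bounded_operator mu D -> (S < +oo)%E.
  move=> [_ _ [M DM]].
  (* From [M ||f||] one passes to [|M|]: [||f|| <= 1] bounds only [|M| ||f||]. *)
  apply: le_lt_trans (ltry (`|M| - 1)); apply: S_le => v vo.
  apply: le_trans (DM _ (Linfty_edge_fun adj o mu mu_pos v)) _.
  have := wnorm_edge_fun_le1 adj o mu mu_pos v.
  have [c c0 ->] := Linfty_wnormE mu mu_ge0 _ v (Linfty_edge_fun adj o mu mu_pos v).
  rewrite -EFinM !lee_fin => c1.
  rewrite (le_trans (ler_norm _))// normrM (ger0_norm c0).
  exact: ler_piMr.
split.
  split=> // /S_finite[s s0 Ss].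
  have DB f : Linfty mu f -> (wnorm mu (D f) <= (1 + s)%:E * wnorm mu f)%E.
    move=> /(Linfty_wnormE mu mu_ge0 _ o)[c c0 fc].
    by rewrite fc -EFinM; apply: D_le; rewrite ?fc.
  split=> [f Lf|a f g _ _|]; last by exists (1 + s).
  - apply: le_lt_trans (DB f Lf) _.
    by have [c _ ->] := Linfty_wnormE mu mu_ge0 _ o Lf; rewrite -EFinM ltry.
  - exact: diff_op_linear.
move=> /S_bounded/S_finite[s s0 Ss].
have norm_le : (opnorm mu D <= (1 + s)%:E)%E.
  apply: ge_ereal_sup => _ [f [_ f1] <-].
  by rewrite -[1 + s]mulr1; apply: D_le.
have edge_le v : (wnorm mu (D (edge_fun adj o mu v)) <= opnorm mu D)%E.
  apply: ereal_sup_ubound; exists (edge_fun adj o mu v) => //; split.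
    exact: Linfty_edge_fun.
  exact: wnorm_edge_fun_le1.
have norm_fin : opnorm mu D \is a fin_num.
  rewrite ge0_fin_numE ?(le_lt_trans norm_le) ?ltry//.
  exact: le_trans (wnorm_ge0 mu mu_ge0 _ o) (edge_le o).
apply/eqP; rewrite eq_le Ss -EFinD norm_le /=.
have := S_le (fine (opnorm mu D)).
rewrite fineK// => /(_ (fun v _ => edge_le v)).
by rewrite Ss lee_fin lerBrDl -lee_fin fineK.
Qed.
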